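(* Let $(X,D)$ be an $\mathcal{F}$-metric space with respect to some $(f,\alpha)\in\mathcal{F}\times[0,\infty)$, and equip $X$ with the topology $\tau_{\mathcal{F}}$ generated by $D$. Then $X$ is metrizable, i.e. there exists a metric $d$ on $X$ whose induced topology equals $\tau_{\mathcal{F}}$.
   Context: Let $\mathcal{F}$ denote the class of functions $f:(0,\infty)\to\mathbb{R}$ satisfying the following two conditions: ($\mathcal{F}_1$) $f$ is non-decreasing, i.e. $0<s<t$ implies $f(s)\le f(t)$; ($\mathcal{F}_2$) for every sequence $\{t_n\}_{n\in\mathbb{N}}\subseteq(0,\infty)$, one has $\lim_{n\to\infty}t_n=0$ if and only if $\lim_{n\to\infty}f(t_n)=-\infty$. Let $X$ be a non-empty set and $D:X\times X\to[0,\infty)$ a mapping. $D$ is called an $\mathcal{F}$-metric on $X$, and $(X,D)$ an $\mathcal{F}$-metric space (with respect to $(f,\alpha)$), if there exists $(f,\alpha)\in\mathcal{F}\times[0,\infty)$ such that: (D1) for all $(x,y)\in X\times X$, $D(x,y)=0$ if and only if $x=y$; (D2) $D(x,y)=D(y,x)$ for all $(x,y)\in X\times X$; (D3) for every $(x,y)\in X\times X$, every $N\in\mathbb{N}$ with $N\ge2$, and every $(u_i)_{i=1}^{N}\subseteq X$ with $(u_1,u_N)=(x,y)$, $$D(x,y)>0\ \Longrightarrow\ f(D(x,y))\le f\left(\sum_{i=1}^{N-1}D(u_i,u_{i+1})\right)+\alpha.$$ The topology $\tau_{\mathcal{F}}$ generated by $D$: a subset $O\subseteq X$ is open if and only if for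 every $x\in O$ there exists $r>0$ such that $\{y\in X: D(x,y)<r\}\subseteq O$. *)

(* Defs.v *)
From HB Require Import structures.
From mathcomp Require Import all_boot all_order all_algebra.
From mathcomp Require Import all_classical all_reals all_analysis.

Set Implicit Arguments.
Unset Strict Implicit.
Unset Printing Implicit Defensive.

Import Order.TTheory GRing.Theory Num.Theory.
Import numFieldNormedType.Exports.

Local Open Scope classical_set_scope.
Local Open Scope ring_scope.

(* A function on (0, +oo) is encoded as a function on R, of which only the
   values at positive reals are constrained. *)
Definition classF (R : realType) (f : R -> R) : Prop :=
  (forall s t : R, 0 < s -> s < t -> f s <= f t) /\
  (forall t : nat -> R, (forall n, 0 < t n) ->
     (t n @[n --> \oo] --> (0 : R)) <-> (f (t n) @[n --> \oo] --> -oo%R)).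

(* The argument of f in the last clause is positive as soon as D x y is, by the
   first two clauses: f is never used outside (0, +oo). *)
Definition Fmetric_wrt (R : realType) (X : Type) (D : X -> X -> R)
    (f : R -> R) (alpha : R) : Prop :=
  [/\ forall x y, 0 <= D x y,
      forall x y, D x y = 0 <-> x = y,
      forall x y, D x y = D y x
    & forall (x y : X) (N : nat) (u : nat -> X),
        (2 <= N)%N -> u 1%N = x -> u N = y -> 0 < D x y ->
        f (D x y) <= f (\sum_(1 <= i < N) D (u i) (u i.+1)) + alpha].

Definition Fmetric (R : realType) (X : Type) (D : X -> X -> R) : Prop :=
  exists (f : R -> R) (alpha : R),
    [/\ classF f, 0 <= alpha & Fmetric_wrt D f alpha].

Definition Fopen (R : realType) (X : Type) (D : X -> X -> R) : set (set X) :=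
  [set O | forall x, O x -> exists2 r : R, 0 < r & [set y | D x y < r] `<=` O].

(* A copy of X carrying the topology tau_F; Fopen D is a topology for every D. *)
Definition Fspace (R : realType) (X : Type) (D : X -> X -> R) : Type := X.

Section Fspace_topology.
Variables (R : realType) (X : Type) (D : X -> X -> R).

HB.instance Definition _ := gen_eqMixin (Fspace D).
HB.instance Definition _ := gen_choiceMixin (Fspace D).

Lemma FopenT : Fopen D setT.
Proof. by move=> x _; exists 1. Qed.

Lemma FopenI : setI_closed (Fopen D).
Proof.
move=> A B oA oB x [Ax Bx].
have [r r0 rA] := oA x Ax; have [s s0 sB] := oB x Bx.
exists (Num.min r s); first by rewrite lt_min r0.
by move=> y /=; rewrite lt_min => /andP[/rA Ay /sB By].
Qed.

Lemma Fopen_bigU (I : Type) (F : I -> set X) :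
  (forall i, Fopen D (F i)) -> Fopen D (\bigcup_i F i).
Proof.
move=> oF x [i _ Fix]; have [r r0 rF] := oF i x Fix.
by exists r => // y /rF Fiy; exists i.
Qed.

HB.instance Definition _ :=
  isOpenTopological.Build (Fspace D) FopenT FopenI Fopen_bigU.

Lemma open_FspaceE : @open (Fspace D) = Fopen D.
Proof. by []. Qed.

End Fspace_topology.

(* M is a library metric structure on the carrier of T; it comes with the
   topology induced by its distance. *)
Definition metrizable (R : realType) (T : topologicalType) : Prop :=
  exists M : Metric.axioms_ R T,
    forall O : set T, @open T O <-> @open (Metric.Pack M) O.

(* Main.v *)
From HB Require Import structures.
Require Import Defs.
From mathcomp Require Import all_boot all_order all_algebra.
From mathcomp Require Import all_classical all_reals all_analysis.

(** The metric is the chain distance d(x, y), the infimum of the D-lengths of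
    the finite chains from x to y.  Clearly d <= D.  Conversely, as f(t) tends
    to -oo when t tends to 0+, for every r > 0 there is a delta > 0 such that
    f(t) + alpha < f(r) for 0 < t < delta, and then (D3) and the monotonicity
    of f force D(x, y) < r as soon as some chain from x to y is shorter than
    delta.  So the balls of D and of d are mutually cofinal, and d separates
    points. *)

Set Implicit Arguments.
Unset Strict Implicit.
Unset Printing Implicit Defensive.

Import Order.TTheory GRing.Theory Num.Theory.
Import numFieldNormedType.Exports.

Local Open Scope classical_set_scope.
Local Open Scope ring_scope.

(** Bridge to the bundled structures: [isMetric] builds the topology from the balls of [d], so both
    sides unfold to the same condition on balls. *)
Lemma metric_of_dist (R : realType) (X : Type) (d : X -> X -> R) :
  (forall x, d x x = 0) -> (forall x y, d x y = 0 -> x = y) ->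
  (forall x y, d x y = d y x) ->
  (forall y x z, d x z <= d x y + d y z) ->
  exists M : Metric.axioms_ R X,
    forall O : set X, @open (Metric.Pack M) O <-> Fopen d O.
Proof.
move=> dxx d_eq0 d_sym d_tri.
pose choiceX : choiceType :=
  HB.pack_for choiceType X (gen_eqMixin X) (gen_choiceMixin X).
pose T : metricType R := HB.pack_for (metricType R) X (Choice.class choiceX)
  (@isMetric.Build R choiceX d dxx d_eq0 d_sym d_tri).
exists (Metric.class T) => O.
have -> : @open (Metric.Pack (Metric.class T)) O <-> @open T O by [].
rewrite openE; split=> Oo x /Oo.
- by move=> /nbhs_ballP[r r0]; rewrite ballEmdist => rO; exists r.
- by case=> r r0 rO; apply/nbhs_ballP; exists r; rewrite ?ballEmdist.
Qed.

Section chain_distance.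
Variables (R : realType) (X : Type) (D : X -> X -> R).

(** A chain is its starting point [x] followed by [s], so it is never empty, and it ends at
    [last x s]. *)
Fixpoint chain_length (x : X) (s : seq X) : R :=
  if s is y :: s' then D x y + chain_length y s' else 0.

Definition chain_dist (x y : X) : R :=
  inf [set chain_length x s | s in [set s | last x s = y]].

Lemma chain_length_cat x s t :
  chain_length x (s ++ t) = chain_length x s + chain_length (last x s) t.
Proof. by elim: s x => [|y s IH] x /=; rewrite ?add0r// IH addrA. Qed.

(** Puts the length in the shape of the sum in (D3), whose points are numbered from 1, whence
    [i.-1]. *)
Lemma chain_lengthE x0 x s :
  chain_length x s =
  \sum_(1 <= i < (size s).+1) D (nth x0 (x :: s) i.-1) (nth x0 (x :: s) i).
Proof.
elim: s x => [|y s IH] x; first by rewrite big_geq.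
by rewrite big_nat_recl//= big_add1 IH big_add1.
Qed.

Lemma last_rev_belast (x : X) s : last (last x s) (rev (belast x s)) = x.
Proof. by case: s => //= y s; rewrite rev_cons last_rcons. Qed.

Hypothesis D_ge0 : forall x y, 0 <= D x y.
Hypothesis D_sym : forall x y, D x y = D y x.

Lemma chain_length_ge0 x s : 0 <= chain_length x s.
Proof. by elim: s x => [|y s IH] x //=; rewrite addr_ge0. Qed.

(** The chain [x :: s] read backwards starts at [last x s] and continues with [rev (belast x s)]. *)
Lemma chain_length_rev x s :
  chain_length (last x s) (rev (belast x s)) = chain_length x s.
Proof.
elim: s x => [|y s IH] x //=; rewrite rev_cons -cats1 chain_length_cat IH/=.
by rewrite last_rev_belast addr0 addrC D_sym.
Qed.

Lemma chain_dist_le x s : chain_dist x (last x s) <= chain_length x s.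
Proof.
apply: ge_inf; last by exists s.
by exists 0 => _ [t _ <-]; exact: chain_length_ge0.
Qed.

Lemma chain_dist_lt x y e : chain_dist x y < e ->
  exists2 s, last x s = y & chain_length x s < e.
Proof.
move=> /inf_lt[|_ [s <- <-] se]; last by exists s.
(* The one-step chain shows that the infimum is over a nonempty set. *)
by exists (chain_length x [:: y]), [:: y].
Qed.

Lemma chain_dist_ge0 x y : 0 <= chain_dist x y.
Proof.
rewrite leNgt; apply/negP => /chain_dist_lt[s _].
by rewrite ltNge chain_length_ge0.
Qed.

Lemma chain_distxx x : chain_dist x x = 0.
Proof.
by apply/eqP; rewrite eq_le chain_dist_ge0 andbT (chain_dist_le x [::]).
Qed.

Lemma chain_dist_leD x y : chain_dist x y <= D x y.
Proof. by have := chain_dist_le x [:: y]; rewrite /= addr0. Qed.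

Lemma chain_dist_sym x y : chain_dist x y = chain_dist y x.
Proof.
suff le_sym u v : chain_dist u v <= chain_dist v u.
  by apply/eqP; rewrite eq_le !le_sym.
rewrite leNgt; apply/negP => /chain_dist_lt[s <-]; apply/negP; rewrite -leNgt.
by have := chain_dist_le (last v s) (rev (belast v s));
  rewrite last_rev_belast chain_length_rev.
Qed.

(** Concatenate two chains, each within [e / 2] of its infimum. *)
Lemma chain_dist_triangle y x z :
  chain_dist x z <= chain_dist x y + chain_dist y z.
Proof.
apply/ler_addgt0Pr => e e0; have e2 : 0 < e / 2 by rewrite divr_gt0.
have [s sy xs] : exists2 s, last x s = y &
    chain_length x s < chain_dist x y + e / 2.
  by apply: chain_dist_lt; rewrite ltrDl.
have [t tz yt] : exists2 t, last y t = z &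
    chain_length y t < chain_dist y z + e / 2.
  by apply: chain_dist_lt; rewrite ltrDl.
have := chain_dist_le x (s ++ t).
rewrite last_cat sy tz chain_length_cat sy => /le_trans; apply.
by rewrite [e in leRHS]splitr addrACA lerD// ltW.
Qed.

End chain_distance.

(** The sequence [1 / (n + 1)] tends to 0, so [f] is below [A] at one of its terms, and by
    monotonicity at every smaller positive real. *)
Lemma classF_lt (R : realType) (f : R -> R) (A : R) : classF f ->
  exists2 e : R, 0 < e & forall t, 0 < t -> t < e -> f t < A.
Proof.
move=> [f_mono f_seq]; pose t n : R := n.+1%:R^-1.
have t_gt0 n : 0 < t n by rewrite invr_gt0.
have /(f_seq t t_gt0)/cvgrNyPlt/(_ A) : t n @[n --> \oo] --> (0 : R).
  exact: cvg_harmonic.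
move=> [N _ /(_ N (leqnn N)) ftN]; exists (t N) => // s s0 sN.
exact: le_lt_trans (f_mono _ _ s0 sN) ftN.
Qed.

Lemma Fmetric_small_chain (R : realType) (X : Type) (D : X -> X -> R) (r : R) :
  Fmetric D -> 0 < r ->
  exists2 e : R, 0 < e &
    forall x s, chain_length D x s < e -> D x (last x s) < r.
Proof.
move=> [f [alpha [f_F alpha0 [D_ge0 D_eq0 D_sym f_chain]]]] r0.
have [e e0 fe] := classF_lt (f r - alpha) f_F.
exists e => // x s xs_e; rewrite ltNge; apply/negP => r_le.
have D_gt0 := lt_le_trans r0 r_le.
have s_gt0 : (0 < size s)%N.
  by case: s D_gt0 {xs_e r_le} => //=; have [_ ->//] := D_eq0 x x; rewrite ltxx.
(* [fe] bounds [f] at positive reals only. In a chain of length 0 every step vanishes, so its ends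
   coincide, against [D_gt0]. *)
have xs_gt0 : 0 < chain_length D x s.
  rewrite lt0r chain_length_ge0// andbT; apply/negP => /eqP xs0.
  suff /D_eq0 D0 : x = last x s by rewrite D0 ltxx in D_gt0.
  elim: s x xs0 {xs_e r_le D_gt0 s_gt0} => //= y s IH x /eqP.
  rewrite paddr_eq0 ?chain_length_ge0// => /andP[/eqP xy /eqP ys].
  by rewrite -(IH y ys); apply/D_eq0.
(* [classF] compares [f] at strictly ordered points, so equality is treated apart. *)
have fr : f r <= f (D x (last x s)).
  by move: r_le; rewrite le_eqVlt => /predU1P[<-//|]; apply: f_F.1.
have := f_chain x (last x s) (size s).+1 (fun i => nth x (x :: s) i.-1).
rewrite ltnS s_gt0 /= -[nth _ _ (size s)]/(nth x (x :: s) (size s)) nth_last/=.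
move=> /(_ isT erefl erefl D_gt0); rewrite -(chain_lengthE D x x s).
(* (D3) is contradicted: the length plugged into [f], plus [alpha], is below [f r], hence below
   [f (D x (last x s))]. *)
by rewrite leNgt => /negP; apply; rewrite (lt_le_trans _ fr)// -ltrBrDr fe.
Qed.

Theorem theorem2p1 (R : realType) (X : Type) (D : X -> X -> R)
    (X_nonempty : inhabited X) (D_Fmetric : Fmetric D) :
  metrizable R (Fspace D).
Proof.
have small_chain := Fmetric_small_chain D_Fmetric.
have [D_ge0 D_eq0 D_sym] : [/\ forall x y, 0 <= D x y,
    forall x y, D x y = 0 <-> x = y & forall x y, D x y = D y x].
  by have [f [alpha [_ _ []]]] := D_Fmetric.
have small_dist r : 0 < r ->
    exists2 e, 0 < e & forall x y, chain_dist D x y < e -> D x y < r.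
  move=> /small_chain[e e0 eP]; exists e => // x y xy.
  by have [s <- /eP] := chain_dist_lt xy.
(* If the chain distance is 0, then [D x y] is below every positive [r]. *)
have d_eq0 x y : chain_dist D x y = 0 -> x = y.
  move=> d0; apply/D_eq0/eqP; rewrite eq_le D_ge0 andbT.
  apply/ler_addgt0Pr => r r0; rewrite add0r.
  by have [e e0 /(_ x y)] := small_dist r r0; rewrite d0 => /(_ e0)/ltW.
have [M openM] := metric_of_dist (chain_distxx D_ge0) d_eq0
  (chain_dist_sym D_ge0 D_sym) (chain_dist_triangle D_ge0).
exists M => O; rewrite open_FspaceE; split=> [Oo|/openM Oo].
(* Each [D]-ball contains a chain-distance ball with the same centre; the converse below uses the
   same radius. *)
- apply/openM => x /Oo[r /small_dist[e e0 eP] rO]; exists e => // y /eP.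
  exact: rO.
- move=> x /Oo[r r0 rO]; exists r => // y /= Dr; apply: rO => /=.
  exact: le_lt_trans (chain_dist_leD D_ge0 x y) Dr.
Qed.
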